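(* Let $n$ be a positive integer and let $D=(D_1,D_2,D_3)$ be a tripartite hypergraph degree sequence on $n+n+n$ vertices, i.e. $D_k=(d_{k,1},\dots,d_{k,n})$ is a sequence of $n$ non-negative integers for each $k=1,2,3$. Suppose that $\sum_{i=1}^n d_{1,i}=\sum_{i=1}^n d_{2,i}=\sum_{i=1}^n d_{3,i}$ and that $$\frac{2n^2}{7}\le d_{k,i}\le \frac{5n^2}{7}$$ for all $k\in\{1,2,3\}$ and $i\in\{1,\dots,n\}$. Then $D$ is graphic, i.e. $D$ has a tripartite hypergraph realization.
   Context: A tripartite hypergraph (short for partite $3$-uniform hypergraph) $H=(V_1,V_2,V_3,E)$ has vertex set the disjoint union of finite sets $V_1,V_2,V_3$ (the vertex classes), and $E$ is a set of hyperedges, each hyperedge $e$ being a $3$-element subset of $V_1\cup V_2\cup V_3$ with $|e\cap V_k|=1$ for $k=1,2,3$ (no hyperedge is repeated). The degree of a vertex is the number of hyperedges containing it. A tripartite hypergraph degree sequence $D=(D_1,D_2,D_3)$, with $D_k=(d_{k,1},\dots,d_{k,n_k})$ a sequence of non-negative integers, is graphic if there is a tripartite hypergraph with $|V_k|=n_k$, called a realization of $D$, such that the degrees of the vertices of $V_k$ are $d_{k,1},\dots,d_{k,n_k}$ for each $k=1,2,3$. *)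

(* Defs.v *)
From HB Require Import structures.
From mathcomp Require Import all_boot all_order all_algebra.

Set Implicit Arguments.
Unset Strict Implicit.
Unset Printing Implicit Defensive.

Section TripartiteHypergraph.

Variable V : 'I_3 -> finType.

(* The vertex set is the disjoint union of the three types V k. *)
Definition vertex := {k : 'I_3 & V k}.

Definition vertex_class (k : 'I_3) : {set vertex} := [set v | tag v == k].

Record tripartite_hypergraph := TripartiteHypergraph {
  hyperedges : {set {set vertex}};
  card_hyperedge :
    forall e : {set vertex}, e \in hyperedges -> #|e| = 3;
  card_hyperedge_class :
    forall (e : {set vertex}) (k : 'I_3),
      e \in hyperedges -> #|e :&: vertex_class k| = 1
}.

Definition degree (H : tripartite_hypergraph) (v : vertex) : nat :=
  #|[set e in hyperedges H | v \in e]|.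

(* [perm_eq] because the vertices of an abstract V k carry no labelling: the
   degrees, with multiplicity, are the entries of D k in some order. *)
Definition realization (n : 'I_3 -> nat) (D : forall k, (n k).-tuple nat)
    (H : tripartite_hypergraph) : Prop :=
  forall k : 'I_3,
    #|V k| = n k /\
    perm_eq [seq degree H (Tagged V v) | v : V k] (D k).

End TripartiteHypergraph.

Definition graphic (n : 'I_3 -> nat) (D : forall k, (n k).-tuple nat) : Prop :=
  exists (V : 'I_3 -> finType) (H : tripartite_hypergraph V), realization D H.

(* Main.v *)
Require Import Defs.
From HB Require Import structures.
From mathcomp Require Import all_boot all_order all_algebra.
From mathcomp Require Import zify.
Import Order.TTheory GRing.Theory Num.Theory.

Set Implicit Arguments.
Unset Strict Implicit.
Unset Printing Implicit Defensive.

(* Put b = floor(5n^2/7) and a = n^2 - b, so that all degrees lie in [a, b].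
   If u has larger degree than v in the same class, some hyperedge through u can
   be rerouted through v; hence a hypergraph whose degree sequence majorizes D_k
   in every class k can be transformed into a realization of D. Majorization is
   expressed through the sums of (f(i) - t)_+ over i, for all thresholds t.

   A sequence in [a, b] with sum m is majorized by (b^p, c, a^s), p + 1 + s = n,
   the same for the three classes. So split each class into a set L of p
   vertices, one vertex M, and a set S of s vertices: it suffices to find m
   triples such that, in each class, L receives degree at least pb and S at most
   sa. This is achieved by any set of m triples that contains X and avoids X',
   where X gives L degree at least pb with at most pb + (n-p)a triples, X' gives
   S degree at least sb with at most sb + (n-s)a triples, and X and X' are
   disjoint. X is either LLL together with some triples having two entries in L,
   or the complement of QQQ (Q the complement of L) together with pa triples of
   type LQQ in each class; X' is built likewise from S. In both constructions the
   size bound is the inequality 7s^3 + 4n^3 >= 9sn^2 for s <= n. *)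

(* 2s^3 - 6s^2m + 3sm^2 + 4m^3 is nonnegative because, 16 times over, it exceeds
   (2s + m)(4s - 7m)^2 by 6sm^2 + 15m^3. *)
Lemma cubic_ineq (s m : nat) : 6 * s ^ 2 * m <= 2 * s ^ 3 + 3 * s * m ^ 2 + 4 * m ^ 3.
Proof.
have: (0 <= (2 * s%:Z + m%:Z) * (4 * s%:Z - 7 * m%:Z) ^+ 2)%R.
  by rewrite mulr_ge0 ?sqr_ge0.
rewrite ?expnS ?expn0 ?muln1.
nia.
Qed.

(** Multiplied by 7 and with the extreme values 7b = 5n^2 and 7a = 2n^2 inserted, this is 9sn^2 <=
    7s^3 + 4n^3, which turns into [cubic_ineq] on putting n = s + m. *)
Lemma mul_le_cube n a b s m :
  n = s + m -> 7 * b <= 5 * n ^ 2 -> 2 * n ^ 2 <= 7 * a ->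
  s * b <= s ^ 3 + 2 * m * a.
Proof.
move=> -> hb ha; have := cubic_ineq s m; move: hb ha.
have E: (s + m) ^ 2 = s ^ 2 + 2 * s * m + m ^ 2 by rewrite sqrnD; lia.
rewrite E => hb ha hp.
have: s * (7 * b) <= s * (5 * (s ^ 2 + 2 * s * m + m ^ 2)) by rewrite leq_mul2l hb orbT.
have: m * (2 * (s ^ 2 + 2 * s * m + m ^ 2)) <= m * (7 * a) by rewrite leq_mul2l ha orbT.
move: hp; rewrite ?expnS ?expn0 ?muln1; nia.
Qed.

(** Both p and q are the integer part of the square root of a, so p = q; then 2(2q + 1)^2 <= 7a
    yields q^2 + q < a. *)
Lemma square_add_le q a p :
  p ^ 2 < a -> q ^ 2 < a -> a < p.+1 ^ 2 -> a < q.+1 ^ 2 ->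
  2 * (p + q + 1) ^ 2 <= 7 * a -> q ^ 2 + q <= a.
Proof.
move=> hp hq hP hQ.
have ->: p = q.
  have: p < q.+1 by rewrite -(@ltn_exp2r _ _ 2) //; apply: ltn_trans hQ.
  have: q < p.+1 by rewrite -(@ltn_exp2r _ _ 2) //; apply: ltn_trans hP.
  lia.
nia.
Qed.

Lemma exists_subset_card (T : finType) (A B : {set T}) (m : nat) :
  A \subset B -> #|A| <= m <= #|B| ->
  exists C : {set T}, [/\ A \subset C, C \subset B & #|C| = m].
Proof.
move=> sAB /andP[leAm lemB].
have: m - #|A| <= #|B :\: A| by rewrite cardsDS // leq_sub2r.
case/card_geqP => s [us ss sBA].
have eqs: #|[set x in s]| = m - #|A| by rewrite cardsE -ss; apply/card_uniqP.
exists (A :|: [set x in s]); split; first exact: subsetUl.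
  apply/subsetP => x; rewrite !inE => /orP[|/sBA]; first exact: (subsetP sAB).
  by rewrite inE => /andP[].
rewrite cardsU eqs (_ : A :&: _ = set0) ?cards0 ?subn0 ?subnKC //.
apply/setP => x; rewrite !inE; case: (boolP (x \in s)) => [/sBA|]; rewrite ?andbF //.
by rewrite inE => /andP[/negbTE ->].
Qed.

(** * Majorization and unit transfers *)

Section Majorization.
Variable I : finType.
Implicit Types f d : I -> nat.

Definition excess f t := \sum_i (f i - t).
Definition above f t := \sum_i (t < f i : nat).

Lemma excessS f t : excess f t = excess f t.+1 + above f t.
Proof. by rewrite /excess /above -big_split; apply: eq_bigr => i _ /=; lia. Qed.

Lemma above_le f s t : s <= t -> above f t <= above f s.
Proof. by move=> st; apply: leq_sum => i _; lia. Qed.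

Lemma above_lt_ex f s t : above f t < above f s -> exists i, s < f i <= t.
Proof.
move=> lt; apply/existsP; apply: contraLR lt; rewrite negb_exists -leqNgt => /forallP h.
by apply: leq_sum => i _; have := h i; lia.
Qed.

Lemma above_lt_card f t : above f t < #|I| -> exists i, f i <= t.
Proof.
move=> lt; apply/existsP; apply: contraLR lt; rewrite negb_exists -leqNgt => /forallP h.
by rewrite -sum1_card; apply: leq_sum => i _; have := h i; lia.
Qed.

Lemma above_le_card f t : above f t <= #|I|.
Proof. by rewrite -sum1_card; apply: leq_sum => i _; lia. Qed.

Lemma excess_eq0 f t : (forall i, f i <= t) -> excess f t = 0.
Proof. by move=> h; rewrite /excess big1 // => i _; have := h i; lia. Qed.

(** Second differences of the excess are multiplicities: x + 1 occurs [above f x - above f x.+1]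
    times, and 0 occurs [#|I| - above f 0] times. *)
Lemma perm_eq_excess f d : excess f =1 excess d -> perm_eq (codom f) (codom d).
Proof.
move=> eqfd.
have eqa t : above f t = above d t by have := excessS f t; rewrite !eqfd excessS; lia.
apply/allP => x _ /=; rewrite !count_map.
have cnt (g : I -> nat) : count (preim g (pred1 x)) (enum I) + above g x
    = if x is y.+1 then above g y else #|I|.
  rewrite -sum1_count big_mkcond big_enum /= /above -big_split /=.
  case: x => [|y].
    rewrite -sum1_card; apply: eq_bigr => i _ /=; case: (ltngtP (g i)) => //=; lia.
  apply: eq_bigr => i _ /=; case: (ltngtP (g i)) => //=; lia.
have e : (if x is y.+1 then above f y else #|I|)
    = (if x is y.+1 then above d y else #|I|).
  by case: (x).
rewrite -cnt -cnt enumT eqa in e; exact/eqP/(addIn e).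
Qed.

(* u and v sit at the two ends of a maximal interval of thresholds t at which
   excess d t < excess f t, so moving a unit from u to v preserves majorization. *)
Lemma transfer_pair f d :
  (forall t, excess d t <= excess f t) -> excess f 0 = excess d 0 ->
  ~~ perm_eq (codom f) (codom d) ->
  exists u v, (f v).+1 < f u /\
    forall t, f v < t < f u -> excess d t < excess f t.
Proof.
move=> le eq0 nperm.
have exs: exists t, excess d t < excess f t.
  have [N hN]: exists N, forall i, f i <= N.
    by exists (\max_i f i) => i; apply: leq_bigmax.
  suff /existsP[t h]: [exists t : 'I_N, excess d t < excess f t] by exists t.
  apply: contraR nperm; rewrite negb_exists => /forallP h.
  apply: perm_eq_excess => t; apply/eqP; rewrite eqn_leq le andbT.
  have [tN|Nt] := ltnP t N; first by have := h (Ordinal tN); rewrite -leqNgt.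
  by rewrite excess_eq0 // => i; apply: leq_trans (hN i) Nt.
(* The interval is [s, r): s is the first threshold with strict inequality, r the first one after s
   with equality. *)
case: (ex_minnP exs) => s hs mins.
have exr: exists t, (s < t) && (excess f t == excess d t).
  exists (maxn s.+1 (\max_i f i)); rewrite leq_maxl /=.
  have e0: excess f (maxn s.+1 (\max_i f i)) = 0.
    by apply: excess_eq0 => i; rewrite leq_max leq_bigmax ?orbT.
  by have := le (maxn s.+1 (\max_i f i)); rewrite e0 leqn0 eq_sym.
case: (ex_minnP exr) => r /andP[sr /eqP hr] minr.
have strict t : s <= t < r -> excess d t < excess f t.
  case/andP => st tr; rewrite ltn_neqAle le andbT eq_sym; apply/negP => e.
  have := minr t; rewrite e andbT; case: (ltngtP s t) st => // [|est] _; first by lia.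
  by move: hs; rewrite est (eqP e) ltnn.
have s0: 0 < s by case: s hs {mins exr sr minr strict} => //; rewrite eq0 ltnn.
have eqs: excess f s.-1 = excess d s.-1.
  apply/eqP; rewrite eqn_leq le andbT leqNgt; apply/negP => /mins; lia.
(* Equality at s - 1 and strictness at s make [above f] smaller than [above d] at s - 1, whereas at
   s - 2 it is at least [above d]. Since [above d] is nonincreasing, [above f] drops there, so f
   takes the value s - 1. For s = 1 the bound [#|I|] plays the part of s - 2. The value r is found
   in the same way. *)
have [v hv]: exists v, f v = s.-1.
  have lt: above f s.-1 < above d s.-1.
    have := excessS f s.-1; have := excessS d s.-1; rewrite prednK //; lia.
  case: s s0 eqs lt {hs mins exr sr minr strict} => // -[|s] _ /= eqs lt.
    have [v] := above_lt_card (leq_trans lt (above_le_card d 0)).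
    by rewrite leqn0 => /eqP; exists v.
  have [v] : exists v, s < f v <= s.+1.
    apply: above_lt_ex; have := excessS f s; have := excessS d s; have := le s.
    have := above_le d (leqnSn s); lia.
  by exists v; lia.
have [u hu]: exists u, f u = r.
  have [u hu] : exists u, r.-1 < f u <= r.
    apply: above_lt_ex; have := strict r.-1; have := excessS f r.-1.
    have := excessS d r.-1; have := excessS f r; have := excessS d r; have := le r.+1.
    have := above_le d (leq_pred r); rewrite prednK; lia.
  by exists u; lia.
exists u, v; rewrite hu hv; split; first by lia.
by move=> t ht; apply: strict; lia.
Qed.

(** The hypothesis is f' = f - 1_u + 1_v, written without truncated subtraction. G will be x - t for
    the excess and x^2 for the termination measure. *)
Lemma sum_transfer (G : nat -> nat) f f' u v : u != v ->
  (forall i, f' i + (u == i) = f i + (v == i)) ->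
  \sum_i G (f' i) + (G (f u) + G (f v)) = \sum_i G (f i) + (G (f u).-1 + G (f v).+1).
Proof.
move=> uv h; rewrite (bigD1 u) // (bigD1 v) 1?eq_sym //=.
rewrite [in RHS](bigD1 u) // [in RHS](bigD1 v) 1?eq_sym //=.
rewrite (eq_bigr (fun i => G (f i))); last first.
  move=> i /andP[iu iv]; have := h i; rewrite !(eq_sym _ i) (negbTE iu) (negbTE iv) !addn0.
  by move=> ->.
have := h u; have := h v; rewrite !eqxx (negbTE uv) eq_sym (negbTE uv) addn0 addn1 => -> e.
have ->: f' u = (f u).-1 by lia.
by lia.
Qed.

Lemma excess_transfer f f' u v t : (f v).+1 < f u ->
  (forall i, f' i + (u == i) = f i + (v == i)) ->
  excess f' t + (f v < t < f u) = excess f t.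
Proof.
move=> lt h; have uv: u != v by apply: contraTneq lt => ->; lia.
have := sum_transfer (fun x => x - t) uv h; rewrite -/(excess f t) -/(excess f' t); lia.
Qed.

Lemma sumsq_transfer f f' u v : (f v).+1 < f u ->
  (forall i, f' i + (u == i) = f i + (v == i)) ->
  \sum_i f' i ^ 2 < \sum_i f i ^ 2.
Proof.
move=> lt h; have uv: u != v by apply: contraTneq lt => ->; lia.
have := sum_transfer (fun x => x ^ 2) uv h => /=; move: lt.
case: (f u) => // x /=; nia.
Qed.

End Majorization.

(** * The three class indices and a discrete intermediate value *)

Lemma third_index (i j : 'I_3) : exists k, (k != i) && (k != j).
Proof.
apply/existsP; apply: contraT; rewrite negb_exists => /forallP h.
have : #|[set: 'I_3]| <= #|[set i; j]|.
  by apply/subset_leq_card/subsetP => k _; have := h k; rewrite !inE negb_and !negbK.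
by rewrite cardsT card_ord cards2; case: (_ != _).
Qed.

Lemma cyclic_cases (i j : 'I_3) : i != j ->
  exists2 k, (forall l, [|| l == i, l == j | l == k]) & (j == ordS i) || (i == ordS j).
Proof.
move=> ij; exists (ordS (if j == ordS i then j else i)).
  by move=> l; case: i j l ij => [[|[|[|]]] ?] // [[|[|[|]]] ?] // [[|[|[|]]] ?].
by case: i j ij => [[|[|[|]]] ?] // [[|[|[|]]] ?].
Qed.

Lemma discrete_ivt (g : nat -> nat) m x : 0 < m -> g 0 <= x <= g m ->
  exists2 p, p < m & g p <= x <= g p.+1.
Proof.
elim: m => // -[|m] IH _ /andP[h0 hm]; first by exists 0; rewrite // h0.
have [xg|gx] := leqP x (g m.+1).
  by have [//||p pm hp] := IH; [rewrite h0 | exists p => //; apply: ltnW].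
by exists m.+1 => //; rewrite hm (ltnW gx).
Qed.

(** * Sets of triples, their degrees and hinge flips *)

Section Triples.
Variable n : nat.
Local Notation triple := {ffun 'I_3 -> 'I_n}.
Implicit Types (H X Y : {set triple}) (A B L S : {set 'I_n}) (k : 'I_3) (e : triple).

Definition incident X k A : {set triple} := [set e in X | e k \in A].
Definition deg X k (i : 'I_n) : nat := #|incident X k [set i]|.

Lemma sum_deg X k A : \sum_(i in A) deg X k i = #|incident X k A|.
Proof.
rewrite -sum1_card (partition_big (fun e => e k) (mem A)) => [|e]; last first.
  by rewrite inE => /andP[].
apply: eq_bigr => i iA; rewrite /deg -sum1_card; apply: eq_bigl => e.
by rewrite !inE -andbA; case: eqP => [->|]; rewrite ?andbF // iA.
Qed.

Lemma sum_degT X k : \sum_i deg X k i = #|X|.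
Proof.
transitivity #|incident X k setT|.
  by rewrite -sum_deg; apply: eq_bigl => i; rewrite inE.
by apply: eq_card => e; rewrite !inE andbT.
Qed.

Definition upd e k (v : 'I_n) : triple := [ffun j => if j == k then v else e j].

Lemma upd_inj_on k u v : 
  {in [pred e : triple | e k == u] &, injective (fun e => upd e k v)}.
Proof.
move=> e1 e2; rewrite !inE => /eqP h1 /eqP h2 /ffunP eq12; apply/ffunP => j.
by have := eq12 j; rewrite !ffunE; case: eqP => // ->; rewrite h1 h2.
Qed.

Lemma deg_swap H e x k i : e \in H -> x \notin H ->
  deg (x |: (H :\ e)) k i + (e k == i) = deg H k i + (x k == i).
Proof.
move=> eH xH; rewrite /deg.
have xNe : x != e by apply: contraNneq xH => ->.
have := cardsD1 x (incident (x |: (H :\ e)) k [set i]).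
have := cardsD1 e (incident H k [set i]).
rewrite !inE !eqxx eH /= => -> ->.
rewrite (_ : _ :\ x = incident H k [set i] :\ e); first by rewrite addnC addnA addnAC.
apply/setP => y; rewrite !inE; have [->|_] /= := eqVneq y x; last by rewrite andbA.
by rewrite (negbTE xH) andbF.
Qed.

(** Replacing u by v in coordinate k is injective on the triples through u, so by counting some
    image lies outside H; it is exchanged for its preimage. *)
Lemma hinge_flip H k u v : deg H k v < deg H k u ->
  exists H', [/\ forall i, deg H' k i + (u == i) = deg H k i + (v == i)
               & forall j i, j != k -> deg H' j i = deg H j i].
Proof.
move=> lt.
have: ~~ ((fun e => upd e k v) @: incident H k [set u] \subset incident H k [set v]).
  apply: contraL lt => /subset_leq_card; rewrite card_in_imset -?leqNgt // => e1 e2.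
  by rewrite !inE => /andP[_ h1] /andP[_ h2]; apply: (@upd_inj_on k u).
case/subsetPn => _ /imsetP[e + ->]; rewrite !inE => /andP[eH /eqP eu].
rewrite ffunE !eqxx andbT => xH.
exists (upd e k v |: (H :\ e)); split => [i|j i jk].
  by have := deg_swap k i eH xH; rewrite ffunE eqxx eu.
by have := deg_swap j i eH xH; rewrite ffunE (negbTE jk) => /addIn.
Qed.

Lemma majorized_realized H (d : 'I_3 -> 'I_n -> nat) :
  (forall k t, excess (d k) t <= excess (deg H k) t) ->
  (forall k, \sum_i d k i = #|H|) ->
  exists H', forall k, perm_eq (codom (deg H' k)) (codom (d k)).
Proof.
move=> + sumd; have: forall k, \sum_i deg H k i = \sum_i d k i.
  by move=> k; rewrite sum_degT.
(* Every flip used lowers the sum of the squared degrees, so the process ends. *)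
have [m] := ubnP (\sum_k \sum_i deg H k i ^ 2).
elim: m H {sumd} => // m IH H; rewrite ltnS => lem sumd le.
case: (boolP [forall k, perm_eq (codom (deg H k)) (codom (d k))]) => [/forallP h|].
  by exists H.
rewrite negb_forall => /existsP[k nperm].
have e0 f : @excess 'I_n f 0 = \sum_i f i by apply: eq_bigr => i _; rewrite subn0.
have [|u [v [lt strict]]] := transfer_pair (le k) _ nperm; first by rewrite !e0 sumd.
have [H' [flip same]] := @hinge_flip H k u v (ltnW lt).
(* The excess falls only in class k, by one, and only at thresholds where [strict] leaves room. *)
have ex j t : excess (deg H' j) t + (j == k) * (deg H k v < t < deg H k u)
    = excess (deg H j) t.
  have [->|jk] := eqVneq j k; first by rewrite mul1n excess_transfer.
  by rewrite addn0; apply: eq_bigr => i _; rewrite same.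
apply: (IH H').
- apply: leq_trans lem; rewrite (bigD1 k) // [in ltnRHS](bigD1 k) //=.
  rewrite (eq_bigr (fun j => \sum_i deg H j i ^ 2)) ?ltn_add2r ?(sumsq_transfer lt flip) //.
  by move=> j jk; apply: eq_bigr => i _; rewrite same.
- by move=> j; rewrite -sumd -!e0 -[RHS](ex j) ltn0 muln0 addn0.
move=> j t; have := ex j t; have := le j t; have := strict t.
by case: (eqVneq j k) => [->|_]; case: (_ < t < _) => //=; lia.
Qed.

(** * Blocks of triples and their cardinalities *)

Definition block (F : 'I_3 -> {set 'I_n}) : {set triple} :=
  [set e : triple | [forall j, e j \in F j]].

Lemma card_block F : #|block F| = \prod_j #|F j|.
Proof.
transitivity #|family F|; first by apply: eq_card => e; rewrite inE.
by rewrite card_family foldrE big_map big_enum.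
Qed.

Definition cube A := block (fun=> A).
Definition slot k A B := block (fun j => if j == k then A else B).

Lemma slotP k A B e :
  reflect (e k \in A /\ forall j, j != k -> e j \in B) (e \in slot k A B).
Proof.
rewrite inE; apply: (iffP forallP) => [h|[h1 h2] j].
  by split=> [|j /negbTE jk]; [have := h k; rewrite eqxx | have := h j; rewrite jk].
by case: eqVneq => [->|/h2].
Qed.

Lemma cubeP A e : reflect (forall j, e j \in A) (e \in cube A).
Proof. by rewrite inE; apply: forallP. Qed.

Lemma slotS k A A' B B' : A \subset A' -> B \subset B' ->
  slot k A B \subset slot k A' B'.
Proof.
move=> /subsetP sA /subsetP sB; apply/subsetP => e /slotP[h1 h2]; apply/slotP.
by split=> [|j /h2 /sB //]; apply: sA.
Qed.

Lemma card_cube A : #|cube A| = #|A| ^ 3.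
Proof. by rewrite card_block prod_nat_const card_ord. Qed.

Lemma card_slot k A B : #|slot k A B| = #|A| * #|B| ^ 2.
Proof.
rewrite card_block (bigD1 k) //= eqxx; congr muln.
rewrite (eq_bigr (fun=> #|B|)) => [|j /negbTE ->//].
rewrite prod_nat_const; congr expn.
by have := cardC1 k; rewrite card_ord; apply: etrans; apply: eq_card.
Qed.

Lemma card_incidentT k A : #|incident setT k A| = #|A| * n ^ 2.
Proof.
have cT : #|[set: 'I_n]| = n by rewrite cardsT card_ord.
rewrite -[in X in _ * X ^ 2]cT -(card_slot k); apply: eq_card => e.
apply/idP/slotP => [|[]]; rewrite !inE //= => h; split=> // j _; exact: in_setT.
Qed.

Lemma card_incidentC X k A : #|incident X k A| + #|incident X k (~: A)| = #|X|.
Proof.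
rewrite -(cardsID [set e : triple | e k \in A] X); congr addn; apply: eq_card => e; rewrite !inE //.
by rewrite andbC.
Qed.

Lemma card_incidentD X k A : #|incident (~: X) k A| = #|A| * n ^ 2 - #|incident X k A|.
Proof.
rewrite -(card_incidentT k) -cardsDS; last by apply/subsetP => e; rewrite !inE => /andP[].
by apply: eq_card => e; rewrite !inE; case: (_ \in X); case: (_ \in A).
Qed.

Lemma card_leq_set (A : {set 'I_n}) : #|A| <= n.
Proof. by rewrite -[leqRHS]card_ord max_card. Qed.

(** The common shape of the sets built below or of their complements. When [C k] lies in
    [slot k (~: S) S], the union is disjoint and its triples leaving S in class k are those of
    [C k], so all counts reduce to the sizes of S and [C k]. *)
Definition cube_slots S (C : 'I_3 -> {set triple}) := cube S :|: \bigcup_k C k.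

Lemma cube_slots_sub A (B : 'I_3 -> {set triple}) Y :
  cube A \subset Y -> (forall k, B k \subset Y) -> cube_slots A B \subset Y.
Proof. by move=> sA sB; rewrite subUset sA; apply/bigcupsP. Qed.

Lemma sub_cube_slots A (B : 'I_3 -> {set triple}) k : B k \subset cube_slots A B.
Proof. by apply: subset_trans (subsetUr _ _); apply: bigcup_sup. Qed.

Section CubeSlots.
Variables (S : {set 'I_n}) (C : 'I_3 -> {set triple}).
Hypothesis subC : forall k, C k \subset slot k (~: S) S.

Lemma cube_slots_incident k : incident (cube_slots S C) k (~: S) = C k.
Proof.
apply/setP => e; rewrite !inE; apply/idP/idP => [/andP[/orP[/forallP/(_ k)->//|]]|h].
  case/bigcupP => j _ h /negP kS.
  have /slotP[_ /(_ k)] := subsetP (subC j) _ h.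
  by case: eqVneq => [->//|_ /(_ isT)].
have /slotP[] := subsetP (subC k) _ h; rewrite inE => -> _; rewrite andbT.
by apply/orP; right; apply/bigcupP; exists k.
Qed.

Lemma card_cube_slots : #|cube_slots S C| = #|S| ^ 3 + \sum_k #|C k|.
Proof.
rewrite cardsU card_cube (_ : _ :&: _ = set0) ?cards0 ?subn0.
  congr addn; rewrite -sum1_card partition_disjoint_bigcup.
    by apply: eq_bigr => k _; rewrite sum1_card.
  move=> i j ij; rewrite -setI_eq0; apply/eqP/setP => e; rewrite !inE.
  apply/negbTE/negP => /andP[/(subsetP (subC i))/slotP[ei _]].
  by move=> /(subsetP (subC j))/slotP[_ /(_ _ ij)]; apply/negP; rewrite inE in ei.
apply/setP => e; rewrite !inE; apply/negbTE/negP => /andP[/forallP h /bigcupP[k _]].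
by move/(subsetP (subC k))/slotP=> []; rewrite inE h.
Qed.

End CubeSlots.
Lemma mem_full_slots A e : e \in cube_slots A (fun k => slot k (~: A) A) ->
  exists k, forall j, j != k -> e j \in A.
Proof.
rewrite inE => /orP[/cubeP h|/bigcupP[k _ /slotP[_ h]]]; first by exists ord0.
by exists k.
Qed.

Definition cyclic_block k A B C : {set triple} :=
  block (fun j => if j == k then A else if j == ordS k then B else C).

Lemma card_cyclic_block k A B C : #|cyclic_block k A B C| = #|A| * #|B| * #|C|.
Proof.
rewrite card_block (bigD1 k) //= eqxx -mulnA; congr muln.
have kS : ordS k != k by case: k => [[|[|[|]]] ?].
rewrite (bigD1 (ordS k)) //= (negbTE kS) eqxx; congr muln.
have kSS : (ordS (ordS k) != k) && (ordS (ordS k) != ordS k) by case: k {kS} => [[|[|[|]]] ?].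
rewrite (bigD1 (ordS (ordS k))) //= big_pred0 => [|j].
  by case/andP: kSS => /negbTE -> /negbTE ->; rewrite muln1.
by case: j k {kS kSS} => [[|[|[|]]] ?] // [[|[|[|]]] ?].
Qed.

Lemma cyclic_blockP k (A B C : {set 'I_n}) e : e k \in A -> e (ordS k) \in B ->
  (forall j, j != k -> j != ordS k -> e j \in C) -> e \in cyclic_block k A B C.
Proof.
move=> eA eB eC; rewrite inE; apply/forallP => j.
by have [->|jk] := eqVneq j k; last have [->|jS] := eqVneq j (ordS k); last exact: eC.
Qed.

End Triples.

(** For every set A, the excess of f at t is at least the sum of f(i) - t over A. Take A to be
    everything if t < a; otherwise L if at most |L| entries of d exceed t, and the complement of S
    if more do. *)
Lemma majorize_two_valued (I : finType) (L S : {set I}) (f d : I -> nat) (a b : nat) :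
  [disjoint L & S] -> #|L| + #|S| + 1 = #|I| ->
  \sum_i f i = \sum_i d i -> (forall i, a <= d i <= b) ->
  #|L| * b <= \sum_(i in L) f i -> \sum_(i in S) f i <= #|S| * a ->
  forall t, excess d t <= excess f t.
Proof.
move=> disj cardI eqs bd hL hS t.
have low (A : {set I}) : \sum_(i in A) f i <= excess f t + #|A| * t.
  rewrite -sum_nat_const /excess (bigID (mem A) xpredT (fun i => f i - t)) /= addnAC.
  apply: leq_trans (leq_addr _ _); rewrite -big_split /=.
  by apply: leq_sum => i _; lia.
pose J := [set i | t < d i].
have eJ : \sum_(i in J) d i = excess d t + #|J| * t.
  rewrite -sum_nat_const /excess (bigID (mem J) xpredT (fun i => d i - t)) /=.
  rewrite addnAC [X in _ + X]big1; last first.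
    by move=> i; rewrite inE; lia.
  by rewrite addn0 -big_split; apply: eq_bigr => i; rewrite inE /=; lia.
have leJb : \sum_(i in J) d i <= #|J| * b.
  by rewrite -sum_nat_const; apply: leq_sum => i _; case/andP: (bd i).
have sumJ : \sum_(i in J) d i + #|~: J| * a <= \sum_i d i.
  rewrite [leqRHS](bigID (mem J)) /= leq_add2l -sum_nat_const.
  rewrite (eq_bigl (fun i => i \notin J)) => [|i]; last by rewrite inE.
  by apply: leq_sum => i _; case/andP: (bd i).
have sumS : \sum_i d i <= \sum_(i in ~: S) f i + #|S| * a.
  rewrite -eqs (bigID (mem S)) /= addnC leq_add // leq_eqVlt; apply/orP; left.
  by apply/eqP; apply: eq_bigl => i; rewrite inE.
have := low L; have := low (~: S); have := cardsC J; have := cardsC S.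
have [ta|at_] := ltnP t a.
  have JT : J = setT by apply/setP => i; rewrite !inE; case/andP: (bd i); lia.
  have eT (g : I -> nat) : \sum_(i in setT) g i = \sum_i g i.
    by apply: eq_bigl => i; rewrite inE.
  by have := low setT; move: eJ; rewrite JT !eT eqs; lia.
have [jp|pj] := leqP #|J| #|L|; last by nia.
case: (leqP t b) => tb; nia.
Qed.

(** * Construction of X and X' *)

Section Construction.
Variables n a b : nat.
Hypothesis ab : a + b = n ^ 2.
Hypothesis key : forall s, s <= n -> s * b <= s ^ 3 + 2 * (n - s) * a.
Local Notation triple := {ffun 'I_3 -> 'I_n}.
Implicit Types (H X Y : {set triple}) (A L S : {set 'I_n}) (k : 'I_3) (e : triple).

(** Used for X with A = L and for X' with A = S. Since a + b = n^2, triples avoiding X' give S at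
    most |S| a in each class. *)
Definition saturating A X :=
  (forall k, #|A| * b <= #|incident X k A|) /\ #|X| <= #|A| * b + (n - #|A|) * a.

Lemma saturating_cube_slots S (B : 'I_3 -> {set triple}) :
  (forall k, B k \subset slot k (~: S) S) ->
  (forall k, #|S| * b <= #|S| ^ 3 + 2 * #|B k|) ->
  exists2 X, saturating S X & X \subset cube_slots S B.
Proof.
move=> subB leB; have [small|big] := leqP (#|S| * b) (#|S| ^ 3).
  have [||X [_ sX cX]] := @exists_subset_card _ set0 (cube S) (#|S| * b).
  - exact: sub0set.
  - by rewrite cards0 card_cube small.
  exists X; last exact: subset_trans sX (subsetUl _ _).
  split=> [k|]; last by rewrite cX leq_addr.
  rewrite -cX; apply/subset_leq_card/subsetP => e eX; rewrite inE eX.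
  by have /cubeP := subsetP sX _ eX; apply.
have [D eD] : exists D, D = #|S| * b - #|S| ^ 3 by exists (#|S| * b - #|S| ^ 3).
have [h /andP[Dh hD]] : exists h, D <= 2 * h <= D.+1 by exists (uphalf D); lia.
(* A triple of [C k] meets S in the two classes other than k, so any two of the three sizes must add
   up to at least D. The sizes h, h, D - h with h = ceil(D/2) do so with least total D + h, and
   [key] bounds h by (n - |S|) a. *)
pose c k := if k == ord_max then D - h else h.
have exC k : exists C : {set triple}, C \subset B k /\ #|C| = c k.
  have [||C [_ sC cC]] := @exists_subset_card _ set0 (B k) (c k); first exact: sub0set.
    by rewrite cards0 leq0n /c; have := leB k; case: ifP => _; lia.
  by exists C.
have [C hC] := fin_all_exists exC.
have subC k : C k \subset slot k (~: S) S by apply: subset_trans (subB k); case: (hC k).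
have sumC : \sum_k #|C k| = D + h.
  rewrite (eq_bigr c) => [|k _]; last by case: (hC k).
  by rewrite !big_ord_recl big_ord0 /c /=; lia.
exists (cube_slots S C); last first.
  by apply: setUS; apply/bigcupsP => k _; apply: subset_trans (bigcup_sup k _); case: (hC k).
have cX := card_cube_slots subC.
split=> [k|]; last by rewrite cX sumC; have := key (card_leq_set S); rewrite -mulnA; move: (_ * a); lia.
have := card_incidentC (cube_slots S C) k S.
rewrite cube_slots_incident // (proj2 (hC k)) cX sumC /c; case: ifP => _; lia.
Qed.

(** L receives exactly |L| n^2 - |L| a = |L| b in each class. Writing n^3 as (|L| + |~: L|)(a + b)
    reduces the size bound to [key] for [~: L]. *)
Lemma saturating_setC_cube_slots L (N : 'I_3 -> {set triple}) :
  (forall k, N k \subset slot k L (~: L)) -> (forall k, #|N k| = #|L| * a) ->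
  saturating L (~: cube_slots (~: L) N).
Proof.
move=> subN cN; have subN' k : N k \subset slot k (~: ~: L) (~: L) by rewrite setCK.
split=> [k|].
  have e := cube_slots_incident subN' k; rewrite setCK in e.
  by rewrite card_incidentD e cN -ab mulnDr addKn.
have := cardsC (cube_slots (~: L) N); rewrite (card_cube_slots subN') card_ffun !card_ord.
rewrite (eq_bigr (fun=> #|L| * a)) // sum_nat_const card_ord.
have := key (card_leq_set (~: L)); have := cardsC L; rewrite card_ord => h.
have -> : n - #|~: L| = #|L| by lia.
have -> : n - #|L| = #|~: L| by lia.
have -> : n ^ 3 = (#|L| + #|~: L|) * (a + b) by rewrite h ab -expnS.
nia.
Qed.

Section TwoParts.
Variables (L S : {set 'I_n}).
Hypothesis LS : [disjoint L & S].
Hypothesis cardLS : #|L| + #|S| + 1 = n.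

Let M := ~: (L :|: S).
Let p := #|L|.
Let s := #|S|.

Lemma card_setCL : #|~: L| = s.+1.
Proof. by have := cardsC L; rewrite card_ord /s; lia. Qed.

Lemma card_setCS : #|~: S| = p.+1.
Proof. by have := cardsC S; rewrite card_ord /p; lia. Qed.

Lemma card_M : #|M| = 1.
Proof.
have := cardsC (L :|: S); rewrite card_ord cardsU (disjoint_setI0 LS) cards0 -/M; lia.
Qed.

Lemma notin_S i : i \in L -> i \notin S.
Proof. by move=> iL; rewrite (disjointFr LS). Qed.

Lemma notin_L i : i \in S -> i \notin L.
Proof. by move=> iL; rewrite (disjointFl LS). Qed.

Lemma subSCL : S \subset ~: L.
Proof. by apply/subsetP => i; rewrite inE => /notin_L. Qed.

Definition separated := exists X X' : {set triple},
  [/\ saturating L X, saturating S X' & [disjoint X & X']].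

(* X contains every triple with two entries in L; of the triples with a single
   entry in L it omits, per class, |L| a triples of type LSS, and these serve X'. *)
Lemma separated_large : a <= s ^ 2 -> separated.
Proof.
move=> hs.
have exN k : exists C : {set triple}, C \subset slot k L S /\ #|C| = p * a.
  have [||C [_ sC cC]] := @exists_subset_card _ set0 (slot k L S) (p * a); first exact: sub0set.
    by rewrite cards0 card_slot leq_mul2l hs orbT.
  by exists C.
have [N hN] := fin_all_exists exN.
have subN k : N k \subset slot k L (~: L).
  by apply: subset_trans (proj1 (hN k)) _; apply: slotS => //; apply: subSCL.
have satL := saturating_setC_cube_slots subN (fun k => proj2 (hN k)).
have subM : M \subset ~: S by apply/subsetP => i; rewrite !inE negb_or => /andP[].
have subML : M \subset ~: L by apply/subsetP => i; rewrite !inE negb_or => /andP[].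
have [||X' satS subX'] := @saturating_cube_slots S (fun k => slot k M S :|: N k).
- move=> k; rewrite subUset slotS //=; apply: subset_trans (proj1 (hN k)) _.
  by apply: slotS => //; apply/subsetP => i; rewrite inE => /notin_S.
- move=> k; rewrite cardsU (_ : _ :&: _ = set0); last first.
    apply/setP => e; rewrite in_setI in_set0; apply/negbTE/negP => /andP[/slotP[eM _]].
    move=> /(subsetP (proj1 (hN k)))/slotP[eL _].
    by move: eM; rewrite !inE eL.
  (* [key] offers 2(p + 1) a, and of this a <= s^2 is the size of [slot k M S] while pa is that of
     [N k]. *)
  rewrite cards0 subn0 card_slot card_M (proj2 (hN k)) mul1n.
  have := key (card_leq_set S); have -> : n - #|S| = p.+1 by rewrite /p; lia.
  rewrite -/s; nia.
exists (~: cube_slots (~: L) N), X'; split=> //.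
rewrite disjoint_sym disjoints_subset setCK; apply: subset_trans subX' _.
have subS : cube S \subset cube_slots (~: L) N.
  apply/subsetP => e /cubeP h; rewrite inE; apply/orP; left; apply/cubeP => j.
  exact: (subsetP subSCL).
apply: cube_slots_sub => // k; rewrite subUset sub_cube_slots andbT.
apply/subsetP => e /slotP[h1 h2]; rewrite inE; apply/orP; left; apply/cubeP => j.
case: (eqVneq j k) => [->|/h2]; first exact: (subsetP subML).
exact: (subsetP subSCL).
Qed.

(** Here b = n^2 - a is at most |A|^2 + 2 |A| |~: A|. *)
Lemma card_full_slots A k : #|~: A| ^ 2 <= a ->
  #|A| * b <= #|A| ^ 3 + 2 * #|@slot n k (~: A) A|.
Proof.
move=> h; have := cardsC A; rewrite card_ord card_slot => e.
have : b <= #|A| ^ 2 + 2 * #|A| * #|~: A|.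
  have : a + b = (#|A| + #|~: A|) ^ 2 by rewrite e.
  by rewrite sqrnD; lia.
rewrite !expnS expn0 !muln1; nia.
Qed.

(* X needs only triples with two entries in L, X' only triples with two in S. *)
Lemma separated_middle : s.+1 ^ 2 <= a -> p.+1 ^ 2 <= a -> separated.
Proof.
move=> hs hp.
have [||X satX subX] := @saturating_cube_slots L (fun k => slot k (~: L) L) => // [k|].
  by apply: card_full_slots; rewrite card_setCL.
have [||X' satX' subX'] := @saturating_cube_slots S (fun k => slot k (~: S) S) => // [k|].
  by apply: card_full_slots; rewrite card_setCS.
exists X, X'; split=> //; rewrite -setI_eq0; apply/eqP/setP => e; rewrite !inE.
apply/negbTE/negP => /andP[/(subsetP subX)/mem_full_slots[i hi]].
move=> /(subsetP subX')/mem_full_slots[j hj].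
have [k /andP[ki kj]] := third_index i j.
by have := notin_S (hi k ki); rewrite hj.
Qed.

(** X' uses only triples with two entries in S. X omits them all: those without entry in L lie in
    [cube (~: L)], and the omitted sets [N k] can be chosen to contain all LSS triples because p s^2
    <= pa <= p (s + 1)^2. *)
Lemma separated_mixed : s ^ 2 <= a -> a <= s.+1 ^ 2 -> p.+1 ^ 2 <= a -> separated.
Proof.
move=> hs hs1 hp.
have exN k : exists C : {set triple},
    [/\ slot k L S \subset C, C \subset slot k L (~: L) & #|C| = p * a].
  apply: exists_subset_card; first by apply: slotS => //; apply: subSCL.
  by rewrite !card_slot card_setCL -/p -/s !leq_mul2l hs hs1 !orbT.
have [N hN] := fin_all_exists exN.
have subN k : N k \subset slot k L (~: L) by case: (hN k).
have cN k : #|N k| = p * a by case: (hN k).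
have satL := saturating_setC_cube_slots subN cN.
have [||X' satX' subX'] := @saturating_cube_slots S (fun k => slot k (~: S) S) => // [k|].
  by apply: card_full_slots; rewrite card_setCS.
exists (~: cube_slots (~: L) N), X'; split=> //.
rewrite disjoint_sym disjoints_subset setCK; apply: subset_trans subX' _.
have inCL e : (forall j, e j \in ~: L) -> e \in cube_slots (~: L) N.
  by move=> h; rewrite inE; apply/orP; left; apply/cubeP.
apply: cube_slots_sub => [|k]; apply/subsetP => e.
  by move/cubeP => h; apply: inCL => j; apply: (subsetP subSCL).
case/slotP => ek h; have [eL|eNL] := boolP (e k \in L).
  apply: (subsetP (sub_cube_slots _ _ k)).
  by case: (hN k) => /subsetP sN _ _; apply: sN; apply/slotP.
apply: inCL => j; have [->|jk] := eqVneq j k; first by rewrite inE.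
by apply: (subsetP subSCL); apply: h.
Qed.

End TwoParts.

(** The prescribed part of [N k] has at most |L| (|S|^2 + |S|) triples, the term |L| |S| coming from
    the single vertex outside L and S. *)
Lemma exists_cyclic_slots L S : [disjoint L & S] -> #|L| + #|S| + 1 = n ->
  #|S| ^ 2 + #|S| <= a -> a <= #|S|.+1 ^ 2 ->
  exists N : 'I_3 -> {set triple}, forall k,
    [/\ slot k L S :|: cyclic_block k L S (~: (L :|: S)) \subset N k,
        N k \subset slot k L (~: L) & #|N k| = #|L| * a].
Proof.
move=> LS cardLS h1 h2; suff h k : exists C : {set triple},
    [/\ slot k L S :|: cyclic_block k L S (~: (L :|: S)) \subset C,
        C \subset slot k L (~: L) & #|C| = #|L| * a].
  by have [N hN] := fin_all_exists h; exists N.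
apply: exists_subset_card.
  rewrite subUset slotS ?(subSCL LS) //=; apply/subsetP => e; rewrite inE => /forallP h.
  apply/slotP; split=> [|j jk]; first by have := h k; rewrite eqxx.
  have := h j; rewrite (negbTE jk); case: eqP => _; first exact: (subsetP (subSCL LS)).
  by rewrite !inE negb_or => /andP[].
rewrite card_slot (card_setCL LS cardLS) leq_mul2l h2 orbT andbT.
apply: leq_trans (leq_card_setU _ _) _.
by rewrite card_slot card_cyclic_block (card_M LS cardLS) muln1 -mulnDr leq_mul2l h1 orbT.
Qed.

(* The triples of type L, S, M are shared according to the cyclic orientation. *)
Lemma separated_balanced L S : [disjoint L & S] -> #|L| + #|S| + 1 = n ->
  #|S| ^ 2 + #|S| <= a -> a <= #|S|.+1 ^ 2 ->
  #|L| ^ 2 + #|L| <= a -> a <= #|L|.+1 ^ 2 -> separated L S.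
Proof.
move=> LS cardLS hS hS1 hL hL1.
have [N hN] := exists_cyclic_slots LS cardLS hS hS1.
have SL : [disjoint S & L] by rewrite disjoint_sym.
have cardSL : #|S| + #|L| + 1 = n by lia.
have [N' hN'] := exists_cyclic_slots SL cardSL hL hL1.
exists (~: cube_slots (~: L) N), (~: cube_slots (~: S) N'); split.
- by apply: saturating_setC_cube_slots => k; case: (hN k).
- by apply: saturating_setC_cube_slots => k; case: (hN' k).
rewrite disjoints_subset setCK; apply/subsetP => e; rewrite inE => eN.
apply: contraR eN => eN'.
have [i iS] : exists i, e i \in S.
  apply/existsP; apply: contraR eN'; rewrite negb_exists => /forallP h.
  by rewrite inE; apply/orP; left; apply/cubeP => j; rewrite inE h.
have inN k : e \in N k -> e \in cube_slots (~: L) N := subsetP (sub_cube_slots _ _ k) _.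
have [/existsP[l lL]|] := boolP [exists l, e l \in L]; last first.
  rewrite negb_exists => /forallP h.
  by rewrite inE; apply/orP; left; apply/cubeP => j; rewrite inE h.
have il : l != i by apply: contraTneq lL => ->; apply: notin_L iS.
have [k hk hcyc] := cyclic_cases il.
have inN' j : e \in N' j -> e \in cube_slots (~: S) N' := subsetP (sub_cube_slots _ _ j) _.
(* The third entry decides. LLS triples lie in [N' i] and LSS triples in [N l]; with third entry in
   M, the triple lies in [N l] if class i follows l cyclically, and in [N' i] if l follows i. *)
have [kL|kNL] := boolP (e k \in L).
  case/negP: eN'; apply: (inN' i); case: (hN' i) => /subsetP sN _ _; apply: sN.
  rewrite inE; apply/orP; left; apply/slotP; split=> // j ji.
  by case/or3P: (hk j) => /eqP E; rewrite ?E // in ji *; rewrite eqxx in ji.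
have [kS|kNS] := boolP (e k \in S).
  apply: (inN l); case: (hN l) => /subsetP sN _ _; apply: sN.
  rewrite inE; apply/orP; left; apply/slotP; split=> // j ji.
  by case/or3P: (hk j) => /eqP E; rewrite ?E // in ji *; rewrite eqxx in ji.
case/orP: hcyc => /eqP E.
  apply: (inN l); case: (hN l) => /subsetP sN _ _; apply: sN.
  rewrite inE; apply/orP; right; apply: cyclic_blockP; rewrite -?E // => j jl ji.
  by case/or3P: (hk j) => /eqP F; rewrite F ?eqxx // in jl ji *; rewrite !inE negb_or kNL.
case/negP: eN'; apply: (inN' i); case: (hN' i) => /subsetP sN _ _; apply: sN.
rewrite inE; apply/orP; right; apply: cyclic_blockP; rewrite -?E // => j jl ji.
by case/or3P: (hk j) => /eqP F; rewrite F ?eqxx // in jl ji *; rewrite !inE negb_or kNL andbT.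
Qed.

Lemma separated_sym L S : separated S L -> separated L S.
Proof. by case=> X [X' [h h' d]]; exists X', X; rewrite disjoint_sym. Qed.

(** The cases compare a with the squares of |S|, |S| + 1, |L| and |L| + 1. In the last one,
    [square_add_le] provides the room for the cyclic blocks. *)
Lemma exists_separated L S : 2 * n ^ 2 <= 7 * a ->
  [disjoint L & S] -> #|L| + #|S| + 1 = n -> separated L S.
Proof.
move=> ha LS cardLS.
have SL : [disjoint S & L] by rewrite disjoint_sym.
have cardSL : #|S| + #|L| + 1 = n by lia.
have [|lS] := leqP a (#|S| ^ 2); first exact: separated_large.
have [|lL] := leqP a (#|L| ^ 2).
  by move=> h; apply: separated_sym; apply: separated_large.
have [hS|hS] := leqP (#|S|.+1 ^ 2) a; have [hL|hL] := leqP (#|L|.+1 ^ 2) a.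
- exact: separated_middle.
- by apply: separated_sym; apply: separated_mixed => //; apply: ltnW.
- by apply: separated_mixed => //; apply: ltnW.
have ha' : 2 * (#|L| + #|S| + 1) ^ 2 <= 7 * a by rewrite cardLS.
have ha'' : 2 * (#|S| + #|L| + 1) ^ 2 <= 7 * a by rewrite cardSL.
apply: separated_balanced => //; try exact: ltnW.
  exact: square_add_le lL lS hL hS ha'.
exact: square_add_le lS lL hS hL ha''.
Qed.

Lemma exists_realization (d : 'I_3 -> 'I_n -> nat) m :
  2 * n ^ 2 <= 7 * a -> 0 < n ->
  (forall k, \sum_i d k i = m) -> (forall k i, a <= d k i <= b) ->
  exists H, forall k, perm_eq (codom (deg H k)) (codom (d k)).
Proof.
move=> ha n0 sumd bd.
(* The sum of (b^p, a^(n-p)) goes from na at p = 0 to nb at p = n, and m lies between these. *)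
have [|p pn /andP[lo hi]] := @discrete_ivt (fun p => p * b + (n - p) * a) n m n0.
  rewrite mul0n subn0 subnn mul0n addn0 add0n -(sumd ord0).
  have cst c : n * c = \sum_(i < n) c by rewrite sum_nat_const card_ord.
  rewrite !cst.
  by apply/andP; split; apply: leq_sum => i _; case/andP: (bd ord0 i).
have [||L [_ _ cL]] := @exists_subset_card _ set0 [set: 'I_n] p; first exact: sub0set.
  by rewrite cards0 cardsT card_ord (ltnW pn).
have [||S [_ sS cS]] := @exists_subset_card _ set0 (~: L) (n - p.+1); first exact: sub0set.
  by have := cardsC L; rewrite cards0 card_ord cL; lia.
have LS : [disjoint L & S] by rewrite disjoint_sym disjoints_subset.
have cardLS : #|L| + #|S| + 1 = n by lia.
have [X [X' [[satL cX] [satS cX'] XX']]] := exists_separated ha LS cardLS.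
(* |X| is at most the value at p. As n^3 = n (a + b) and |S| = n - p - 1, the complement of X' has
   at least as many triples as the value at p + 1. *)
have [||H [sXH sHX' cH]] := @exists_subset_card _ X (~: X') m.
- by rewrite -disjoints_subset.
- have := cardsC X'; rewrite card_ffun !card_ord.
  have -> : n ^ 3 = p.+1 * (a + b) + (n - p.+1) * (a + b).
    by rewrite ab -mulnDl subnKC // -expnS.
  move: cX cX'; rewrite cL cS subKn //; nia.
have inc Y Y' k A : Y \subset Y' -> #|@incident n Y k A| <= #|incident Y' k A|.
  move=> /subsetP sY; apply/subset_leq_card/subsetP => e; rewrite !inE.
  by case/andP => /sY -> ->.
apply: (@majorized_realized n H d) => [k t|k]; last by rewrite cH.
apply: (majorize_two_valued LS) (bd k) _ _ t; rewrite ?card_ord ?sum_degT ?sum_deg ?sumd //.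
  by apply: leq_trans (inc _ _ _ _ sXH).
apply: leq_trans (inc _ _ _ _ sHX') _; rewrite card_incidentD -ab.
by have := satS k; lia.
Qed.

End Construction.

(** * From sets of triples to tripartite hypergraphs *)

Section HypergraphOfTriples.
Variables (n : nat) (H : {set {ffun 'I_3 -> 'I_n}}).
Let V (k : 'I_3) : finType := 'I_n.

Definition hyperedge_of (e : {ffun 'I_3 -> 'I_n}) : {set vertex V} :=
  [set Tagged V (e k : V k) | k : 'I_3].

Lemma mem_hyperedge_of e k (i : V k) : (Tagged V i \in hyperedge_of e) = (e k == i).
Proof.
apply/imsetP/eqP => [[j _ eq_t] | <-]; last by exists k.
have jk := congr1 tag eq_t; move: eq_t; rewrite /= in jk *.
by case: _ / jk => /eqP; rewrite eq_Tagged => /eqP.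
Qed.

Lemma hyperedge_of_inj : injective hyperedge_of.
Proof.
move=> e1 e2 /setP eq12; apply/ffunP => k; apply/esym/eqP.
by have := eq12 (Tagged V (e1 k : V k)); rewrite !mem_hyperedge_of eqxx.
Qed.

Lemma card_hyperedge_of e : #|hyperedge_of e| = 3.
Proof. by rewrite card_imset ?card_ord // => k l /(congr1 tag). Qed.

Lemma card_hyperedge_of_class e k : #|hyperedge_of e :&: vertex_class V k| = 1.
Proof.
apply/eqP/cards1P; exists (Tagged V (e k : V k)); apply/setP => -[j i].
rewrite !inE mem_hyperedge_of /=; have [->|jk] := eqVneq j k.
  by rewrite andbT eq_Tagged eq_sym.
by rewrite andbF; apply/esym/negbTE; apply: contra jk => /eqP/(congr1 tag)/= ->.
Qed.

(** Kept transparent so that its hyperedge set unfolds to the image of H. *)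
Definition hypergraph_of : tripartite_hypergraph V.
Proof.
exists [set hyperedge_of e | e in H] => [e | e k] /imsetP[t _ ->].
  exact: card_hyperedge_of.
exact: card_hyperedge_of_class.
Defined.

Lemma degree_hypergraph_of k (i : V k) : degree hypergraph_of (Tagged V i) = deg H k i.
Proof.
rewrite /degree /deg -(card_imset _ hyperedge_of_inj); apply: eq_card => E.
rewrite inE; apply/andP/imsetP => [[/imsetP[e eH ->]]|[e]].
  by rewrite mem_hyperedge_of => eki; exists e; rewrite // !inE eH.
rewrite !inE => /andP[eH eki] ->; rewrite mem_hyperedge_of eki; split=> //.
exact: imset_f.
Qed.
End HypergraphOfTriples.

Local Open Scope ring_scope.

Theorem theorem3p1 (n : nat) (n_gt0 : (0 < n)%N)
    (D : 'I_3 -> n.-tuple nat)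
    (eq_sums : forall k l : 'I_3,
       (\sum_(i < n) tnth (D k) i = \sum_(i < n) tnth (D l) i)%N)
    (bounds : forall (k : 'I_3) (i : 'I_n),
       2 * n%:R ^+ 2 / 7 <= (tnth (D k) i)%:R :> rat /\
       (tnth (D k) i)%:R <= 5 * n%:R ^+ 2 / 7 :> rat) :
  @graphic (fun _ : 'I_3 => n) D.
Proof.
have nat_bounds k i : (2 * n ^ 2 <= 7 * tnth (D k) i <= 5 * n ^ 2)%N.
  case: (bounds k i); rewrite ler_pdivrMr // ler_pdivlMr // -natrX -!natrM !ler_nat.
  by rewrite ![(_ * 7)%N]mulnC => -> ->.
(* Thus a = ceil(2n^2/7), so integrality puts all degrees in [a, b]. *)
pose b := ((5 * n ^ 2) %/ 7)%N; pose a := (n ^ 2 - b)%N.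
have hb : (7 * b <= 5 * n ^ 2)%N by rewrite /b; lia.
have ha : (2 * n ^ 2 <= 7 * a)%N by rewrite /a; lia.
have ab : (a + b = n ^ 2)%N by rewrite /a; lia.
have key s : (s <= n -> s * b <= s ^ 3 + 2 * (n - s) * a)%N.
  by move=> sn; apply: (@mul_le_cube n) => //; rewrite subnKC.
have [|k i|H hH] := exists_realization (d := fun k i => tnth (D k) i)
    (m := (\sum_(i < n) tnth (D ord0) i)%N) ab key ha n_gt0.
- by move=> k; exact: (eq_sums k ord0).
- by have := nat_bounds k i; rewrite /a /b; lia.
exists (fun=> 'I_n : finType), (hypergraph_of H) => k; split; first exact: card_ord.
apply: perm_trans (_ : perm_eq (codom (deg H k)) _).
  by rewrite /codom /image_mem -(eq_map (@degree_hypergraph_of n H k)).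
by apply: perm_trans (hH k) _; rewrite codomE map_tnth_enum.
Qed.
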